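(* For any $n,m,k\in\mathbb{N}$ with $m\le\beta_k(n)$, there is an efficient algorithm for the following problem: If $\lambda_1,\ldots,\lambda_m\in\mathbb{R}_{>0}$ and $q_1,\ldots,q_m\in\mathbb{R}[X_1,\ldots,X_n]_k$ are general forms such that $f_2:=\sum_{i=1}^m\lambda_iq_i^2$ is uniquely Sum-of-Squares representable, compute the set $\{(q_1,\lambda_1),\ldots,(q_m,\lambda_m)\}$ from inputs $f_2$ and $f_3:=\lambda_1q_1^3+\ldots+\lambda_mq_m^3$.
   Context: $\mathbb{R}[X]_k$ is the space of forms of degree $k$ in $X=(X_1,\ldots,X_n)$. $\beta_k(n)$ denotes the maximum number $m$ of $k$-forms $q_1,\ldots,q_m\in\mathbb{R}[X]_k$ that satisfy one of the following equivalent conditions: (1) there are no algebraic relations of $q_1,\ldots,q_m$ of degree at most $3$ (i.e. no nonzero $f\in\mathbb{R}[Y_1,\ldots,Y_m]$ of degree at most $3$ with $f(q_1,\ldots,q_m)=0$); (2) there are no homogeneous algebraic relations of $q_1,\ldots,q_m$ of degree $3$; (3) the space $\mathbb{R}[q_1,\ldots,q_m]_{3k}$, spanned by all threefold products of the $q_i$, has dimension $\binom{m+2}{3}$. A form $f\in\mathbb{R}[X]_{2k}$ is uniquely Sum-of-Squares representable if it has exactly one Sum-of-Squares representation $f=p_1^2+\ldots+p_N^2$ modulo orthogonal transformations of $(p_1,\ldots,p_N)$; equivalently, the Gram spectrahedron $\{G\succeq0\mid[X]_k^TG[X]_k=f\}$, with $[X]_k$ the vector of monomials of degree $k$, is a singleton.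 ''General'' means: for all tuples $(q_1,\ldots,q_m)$ outside some proper Zariski closed subset of $\mathbb{R}[X]_k^m$. ''Efficient'' means: aside from calls to a semidefinite programming solver, which is treated as a blackbox, the algorithm uses only basic linear-algebraic operations on polynomially-sized quantities constructed from the input; numerical issues are ignored. *)

(* Defs.v *)
From mathcomp Require Import all_boot all_order all_algebra.
From mathcomp Require Import mpoly.
From mathcomp Require Import boolp classical_sets reals.

Set Implicit Arguments.
Unset Strict Implicit.
Unset Printing Implicit Defensive.

Import GRing.Theory Num.Theory.

Local Open Scope ring_scope.

Definition monomials (n k : nat) : seq 'X_{1..n} :=
  [seq s2m t | t : k.-tuple 'I_n <- enum (basis n k)].

(* dimension of the space of forms of degree k in n variables *)
Definition nmon (n k : nat) : nat := size (monomials n k).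

Definition mon (n k : nat) (j : 'I_(nmon n k)) : 'X_{1..n} :=
  nth 0%MM (monomials n k) j.

Section Forms.
Variable R : realType.

Definition coefs (n k : nat) (f : {mpoly R[n]}) : 'rV[R]_(nmon n k) :=
  \row_j f@_(mon j).

Definition coefs_family (n k m : nat) (q : 'I_m -> {mpoly R[n]}) :
  'M[R]_(m, nmon n k) := \matrix_(i, j) (q i)@_(mon j).

Definition form_of (n k : nat) (c : 'rV[R]_(nmon n k)) : {mpoly R[n]} :=
  \sum_j c 0 j *: 'X_[mon j].

(* no nonzero algebraic relation of degree at most 3 ([msize] is degree + 1) *)
Definition no_cubic_relation (n m : nat) (q : 'I_m -> {mpoly R[n]}) : Prop :=
  forall f : {mpoly R[m]},
    (msize f <= 4)%N -> f \mPo [tuple q i | i < m] = 0 -> f = 0.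

Definition admissible (n k m : nat) : bool :=
  `[< exists q : 'I_m -> {mpoly R[n]},
        (forall i, q i \is k.-homog) /\ no_cubic_relation q >].

Lemma admissible0 (n k : nat) : exists m, admissible n k m.
Proof.
exists 0%N; apply/asboolP; exists (fun _ => 0); split; first by case.
move=> f _; rewrite (_ : f = (f@_0)%:MP); last first.
  apply/mpolyP => m; rewrite mcoeffC (_ : m = 0%MM) ?eqxx ?mulr1 //.
  by apply/mnmP; case.
rewrite comp_mpolyC => /mpolyP /(_ 0%MM).
by rewrite mcoeffC eqxx mulr1 mcoeff0 => ->; rewrite mpolyC0.
Qed.

Lemma mem_monomials (n k : nat) (u : 'X_{1..n}) :
  (u \in monomials n k) = (mdeg u == k).
Proof. by rewrite basis_cover. Qed.

Lemma admissible_le (n k m : nat) : admissible n k m -> (m <= nmon n k)%N.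
Proof.
move=> /asboolP [q [hq free_q]]; rewrite leqNgt; apply/negP => lt_m.
pose C := coefs_family k q.
have : kermx C != 0.
  by rewrite kermx_eq0 /row_free neq_ltn (leq_ltn_trans (rank_leq_col C)).
case/rowV0Pn => v /sub_kermxP vC0 /eqP; apply; apply/rowP => i; rewrite mxE.
pose f : {mpoly R[m]} := \sum_i v 0 i *: 'X_i.
suff f0 : f = 0.
  have := congr1 (mcoeff U_(i)%MM) f0.
  rewrite raddf_sum /= mcoeff0 (bigD1 i) //= mcoeffZ mcoeffX eqxx mulr1.
  rewrite big1 ?addr0 // => j ne_ji; rewrite mcoeffZ mcoeffX.
  case: eqP => [/(congr1 (fun u : 'X_{1..m} => u j))|_]; last by rewrite mulr0.
  rewrite !mnm1E eqxx; case: (i =P j) => // eq_ij.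
  by rewrite eq_ij eqxx in ne_ji.
apply: free_q.
  apply: leq_trans (msize_sum _ _ _) _; apply/bigmax_leqP => j _.
  by apply: leq_trans (msizeZ_le _ _) _; rewrite msizeX mdeg1.
have -> : f \mPo [tuple q i | i < m] = \sum_i v 0 i *: q i.
  rewrite raddf_sum; apply: eq_bigr => j _ /=.
  by rewrite comp_mpolyZ comp_mpolyXU -tnth_nth tnth_mktuple.
apply/mpolyP => u; rewrite mcoeff0 raddf_sum /=.
have -> : \sum_i (v 0 i *: q i)@_u = \sum_i v 0 i * (q i)@_u.
  by apply: eq_bigr => j _; rewrite mcoeffZ.
case: (mdeg u =P k) => [/eqP|] du.
  rewrite -mem_monomials in du.
  have lt_u : (index u (monomials n k) < nmon n k)%N by rewrite index_mem.
  have /rowP /(_ (Ordinal lt_u)) := vC0; rewrite !mxE => vC0u.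
  rewrite -[RHS]vC0u.
  by apply: eq_bigr => j _; rewrite !mxE /mon nth_index.
rewrite big1 // => j _.
by rewrite (dhomog_nemf_coeff (hq j)) ?mulr0 //; apply/eqP.
Qed.

Definition beta (n k : nat) : nat :=
  ex_maxn (admissible0 n k) (@admissible_le n k).

Definition sos_rep (n k : nat) (f : {mpoly R[n]}) (N : nat)
    (p : 'I_N -> {mpoly R[n]}) : Prop :=
  (forall i, p i \is k.-homog) /\ f = \sum_i p i ^+ 2.

(* Representations of different lengths are compared after padding the shorter
   one with zero forms, so it suffices to compare those of equal length. *)
Definition uniquely_sos (n k : nat) (f : {mpoly R[n]}) : Prop :=
  (exists N (p : 'I_N -> {mpoly R[n]}), sos_rep k f p) /\
  (forall N (p p' : 'I_N -> {mpoly R[n]}),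
     sos_rep k f p -> sos_rep k f p' ->
     exists2 O : 'M[R]_N, O *m O^T = 1%:M &
       forall i, p' i = \sum_j O i j *: p j).

(* A tuple of m forms of degree k is identified with its coefficient matrix. *)
Definition zariski_closed (m N : nat) (Z : set 'M[R]_(m, N)) : Prop :=
  exists S : set {mpoly R[m * N]},
    Z = [set A | forall P, S P -> P.@[fun j => mxvec A 0 j] = 0]%classic.

Definition psd (s : nat) (X : 'M[R]_s) : Prop :=
  X^T = X /\ forall v : 'rV[R]_s, 0 <= (v *m X *m v^T) 0 0.

(* The data (C, A, b) encode the semidefinite program
     minimize <C, X>  subject to  X psd,  <A_i, X> = b_i,
   the i-th row of A being the vectorization of A_i. *)
Definition sdp_feasible (s r : nat) (A : 'M[R]_(r, s * s)) (b : 'rV[R]_r)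
    (X : 'M[R]_s) : Prop :=
  psd X /\ A *m (mxvec X)^T = b^T.

Definition sdp_optimal (s r : nat) (C : 'M[R]_s) (A : 'M[R]_(r, s * s))
    (b : 'rV[R]_r) (X : 'M[R]_s) : Prop :=
  sdp_feasible A b X /\
  forall Y, sdp_feasible A b Y -> \tr (C^T *m X) <= \tr (C^T *m Y).

Definition sdp_solver : Type :=
  forall s r : nat, 'M[R]_s -> 'M[R]_(r, s * s) -> 'rV[R]_r -> 'M[R]_s.

Definition sdp_correct (sdp : sdp_solver) : Prop :=
  forall s r (C : 'M[R]_s) (A : 'M[R]_(r, s * s)) (b : 'rV[R]_r),
    (exists X, sdp_optimal C A b X) -> sdp_optimal C A b (sdp s r C A b).

(* Symmetric eigendecomposition A = P^T * diag(d) * P with P orthogonal (its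
   rows are the eigenvectors) and d sorted decreasingly. *)
Definition eig_solver : Type := forall s : nat, 'M[R]_s -> 'M[R]_s * 'rV[R]_s.

Definition eig_correct (eig : eig_solver) : Prop :=
  forall s (A : 'M[R]_s), A^T = A ->
    let: (P, d) := eig s A in
    [/\ P *m P^T = 1%:M, P^T *m diag_mx d *m P = A
      & forall i j : 'I_s, (i <= j)%N -> d 0 j <= d 0 i].

End Forms.

(* Straight-line programs (with selection) computing a p x q real matrix.
   Variables are de Bruijn indices: [Let e b] evaluates [e] once, and [b] may
   then refer to its value as variable 0. Only 0/1 constants are available; in
   particular the syntax does not depend on the field. *)
Inductive prog : nat -> nat -> Type :=
| Var p q : nat -> prog p q
| Let p q r s : prog p q -> prog r s -> prog r s
| Const p q : 'M[bool]_(p, q) -> prog p q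
| Add p q : prog p q -> prog p q -> prog p q
| Opp p q : prog p q -> prog p q
| Mul p q r : prog p q -> prog q r -> prog p r
| Tr p q : prog p q -> prog q p
| Vec p q : prog p q -> prog 1 (p * q)
| Unvec p q : prog 1 (p * q) -> prog p q
| Had p q : prog p q -> prog p q -> prog p q
| Inv p q : prog p q -> prog p q
| Sqrt p q : prog p q -> prog p q
| Solve p q r : prog p q -> prog r q -> prog r p
| Ker p q : prog p q -> prog p p
| EigVec s : prog s s -> prog s s
| EigVal s : prog s s -> prog 1 s
| Sdp s r : prog s s -> prog r (s * s) -> prog 1 r -> prog s s
| If p q : prog 1 1 -> prog p q -> prog p q -> prog p q.

(* Number of operations plus total number of matrix entries produced. *)
Fixpoint cost p q (e : prog p q) : nat :=
  match e with
  | Var p q _ => 1 + p * q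
  | Let _ _ _ _ a b => 1 + cost a + cost b
  | Const p q _ => 1 + p * q
  | Add p q a b => 1 + p * q + cost a + cost b
  | Opp p q a => 1 + p * q + cost a
  | Mul p _ r a b => 1 + p * r + cost a + cost b
  | Tr p q a => 1 + p * q + cost a
  | Vec p q a => 1 + p * q + cost a
  | Unvec p q a => 1 + p * q + cost a
  | Had p q a b => 1 + p * q + cost a + cost b
  | Inv p q a => 1 + p * q + cost a
  | Sqrt p q a => 1 + p * q + cost a
  | Solve p _ r a b => 1 + r * p + cost a + cost b
  | Ker p _ a => 1 + p * p + cost a
  | EigVec s a => 1 + s * s + cost a
  | EigVal s a => 1 + s + cost a
  | Sdp s _ c a b => 1 + s * s + cost c + cost a + cost b
  | If p q c a b => 1 + p * q + cost c + cost a + cost b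
  end%N.

Section Semantics.
Variables (R : realType) (sdp : sdp_solver R) (eig : eig_solver R).

Definition env : Type := nat -> forall p q : nat, 'M[R]_(p, q).

(* A variable read at the wrong dimensions evaluates to 0. *)
Definition push p q (M : 'M[R]_(p, q)) (E : env) : env :=
  fun i => if i is i'.+1 then E i' else fun r s => conform_mx 0 M.

(* [B *m pinvmx A] is a solution X of X *m A = B whenever there is one. *)
Fixpoint eval (E : env) p q (e : prog p q) : 'M[R]_(p, q) :=
  match e with
  | Var p q i => E i p q
  | Let _ _ _ _ a b => eval (push (eval E a) E) b
  | Const _ _ B => map_mx (fun b : bool => b%:R) B
  | Add _ _ a b => eval E a + eval E b
  | Opp _ _ a => - eval E a
  | Mul _ _ _ a b => eval E a *m eval E b
  | Tr _ _ a => (eval E a)^T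
  | Vec _ _ a => mxvec (eval E a)
  | Unvec _ _ a => vec_mx (eval E a)
  | Had _ _ a b => map2_mx *%R (eval E a) (eval E b)
  | Inv _ _ a => map_mx GRing.inv (eval E a)
  | Sqrt _ _ a => map_mx Num.sqrt (eval E a)
  | Solve _ _ _ a b => eval E b *m pinvmx (eval E a)
  | Ker _ _ a => kermx (eval E a)
  | EigVec s a => (eig (eval E a)).1
  | EigVal s a => (eig (eval E a)).2
  | Sdp s r c a b => sdp (eval E c) (eval E a) (eval E b)
  | If _ _ c a b => if 0 < eval E c 0 0 then eval E a else eval E b
  end.

End Semantics.

Section Problem.
Variable R : realType.
Variables n k : nat.

(* number of coefficients of the input (f2, f3) *)
Definition input_size : nat := (nmon n (2 * k) + nmon n (3 * k))%N.

(* Variable 0 holds the coefficients of f2, variable 1 those of f3. *)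
Definition input_env (f2 f3 : {mpoly R[n]}) : env R :=
  push (coefs (2 * k) f2) (push (coefs (3 * k) f3) (fun _ _ _ => 0)).

(* Row i of the output lists the coefficients of a form followed by a weight. *)
Definition decode (m : nat) (A : 'M[R]_(m, nmon n k + 1)) :
    set ({mpoly R[n]} * R) :=
  range (fun i : 'I_m => (form_of (row i (lsubmx A)), rsubmx A i 0)).

Definition weighted_powers (m : nat) (lam : 'I_m -> R)
    (q : 'I_m -> {mpoly R[n]}) (d : nat) : {mpoly R[n]} :=
  \sum_i lam i *: q i ^+ d.

Definition solves_generically (m : nat) (alg : prog m (nmon n k + 1)) : Prop :=
  exists Z : set 'M[R]_(m, nmon n k),
    [/\ zariski_closed Z, Z <> setT &
      forall (q : 'I_m -> {mpoly R[n]}) (lam : 'I_m -> R),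
        (forall i, q i \is k.-homog) -> (forall i, 0 < lam i) ->
        ~ Z (coefs_family k q) ->
        let f2 := weighted_powers lam q 2 in
        let f3 := weighted_powers lam q 3 in
        uniquely_sos k f2 ->
        forall (sdp : sdp_solver R) (eig : eig_solver R),
          sdp_correct sdp -> eig_correct eig ->
          decode (eval sdp eig (input_env f2 f3) alg) =
          range (fun i : 'I_m => (q i, lam i))].

End Problem.

(* Main.v *)
Require Import Defs.
From mathcomp Require Import all_boot all_order all_algebra.
From mathcomp Require Import mpoly mxtens.
From mathcomp Require Import boolp classical_sets reals.

(* Write C for the coefficient matrix of q and S for the matrix with rows sqrt(lam_i) q_i. By
   uniqueness, the semidefinite program returns the Gram matrix S^T S of f2, and its spectral
   decomposition gives V = O S for some unknown orthogonal O. The absence of cubic relations makes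
   f3 = T(V) solvable for a unique symmetric tensor, T = sum_i sqrt(lam_i)^-1 o_i (x) o_i (x) o_i
   with o_i the columns of O. Contracting T with the vector of coefficients of V at one fixed
   monomial gives the matrix O diag(c_1, ..., c_m) O^T, where c_i is the coefficient of q_i at that
   monomial. The weights have cancelled, so that generically in q alone the c_i are nonzero and
   distinct, and a second spectral decomposition finds the columns of O up to sign and order. *)

Set Implicit Arguments.
Unset Strict Implicit.
Unset Printing Implicit Defensive.

Import Order.TTheory GRing.Theory Num.Theory.
Local Open Scope ring_scope.

(** * Symmetric tensors of order three *)

Definition fst3 (m : nat) (t : 'I_(m * m * m)) : 'I_m :=
  (mxtens_unindex (mxtens_unindex t).1).1.
Definition snd3 (m : nat) (t : 'I_(m * m * m)) : 'I_m :=
  (mxtens_unindex (mxtens_unindex t).1).2.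
Definition thd3 (m : nat) (t : 'I_(m * m * m)) : 'I_m :=
  (mxtens_unindex t).2.
Definition index3 (m : nat) (a b c : 'I_m) : 'I_(m * m * m) :=
  mxtens_index (mxtens_index (a, b), c).

Lemma fst3K m (a b c : 'I_m) : fst3 (index3 a b c) = a.
Proof. by rewrite /fst3 /index3 !mxtens_indexK. Qed.

Lemma snd3K m (a b c : 'I_m) : snd3 (index3 a b c) = b.
Proof. by rewrite /snd3 /index3 !mxtens_indexK. Qed.

Lemma thd3K m (a b c : 'I_m) : thd3 (index3 a b c) = c.
Proof. by rewrite /thd3 /index3 !mxtens_indexK. Qed.

Definition index3K := (fst3K, snd3K, thd3K).

Lemma index3_eta m (t : 'I_(m * m * m)) : index3 (fst3 t) (snd3 t) (thd3 t) = t.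
Proof.
case: (mxtens_indexP t) => ab c; case: (mxtens_indexP ab) => a b.
by rewrite /index3 /fst3 /snd3 /thd3 !mxtens_indexK.
Qed.

Lemma sum_index3 (V : nmodType) m (F : 'I_(m * m * m) -> V) :
  \sum_t F t = \sum_a \sum_b \sum_c F (index3 a b c).
Proof.
rewrite pair_big pair_big /=.
rewrite (reindex (fun p : 'I_m * 'I_m * 'I_m => index3 p.1.1 p.1.2 p.2)) //=.
exists (fun t => (fst3 t, snd3 t, thd3 t)) => [[[a b] c]|t] _ /=.
  by rewrite !index3K.
by rewrite index3_eta.
Qed.

Definition tens3 (A : pzRingType) p q (V : 'M[A]_(p, q)) :
  'M[A]_(p * p * p, q * q * q) := V *t V *t V.

Lemma tens3E (A : pzRingType) p q (V : 'M[A]_(p, q)) t u :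
  tens3 V t u = V (fst3 t) (fst3 u) * V (snd3 t) (snd3 u) * V (thd3 t) (thd3 u).
Proof. by rewrite /tens3 !mxE. Qed.

Lemma tens3_mul (A : comPzRingType) p q r (V : 'M[A]_(p, q)) (W : 'M[A]_(q, r)) :
  tens3 (V *m W) = tens3 V *m tens3 W.
Proof. by rewrite /tens3 !tensmx_mul. Qed.

Lemma tens3_1 (A : comPzRingType) p : tens3 (1%:M : 'M[A]_p) = 1%:M.
Proof.
apply/matrixP => t u; rewrite tens3E !mxE.
rewrite -!natrM !mulnb; congr (nat_of_bool _)%:R.
apply/andP/eqP => [[/andP[/eqP h1 /eqP h2] /eqP h3]|->]; last by rewrite !eqxx.
by rewrite -(index3_eta t) -(index3_eta u) h1 h2 h3.
Qed.

Definition cubic_mon (m : nat) (t : 'I_(m * m * m)) : 'X_{1..m} :=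
  (U_(fst3 t) + U_(snd3 t) + U_(thd3 t))%MM.

(** Its row space is the space of symmetric tensors, with the cubic monomials as coordinates. *)
Definition sym3 (m : nat) : 'M[bool]_(nmon m 3, m * m * m) :=
  \matrix_(i, t) (cubic_mon t == mon i).

Definition mon3 (n k : nat) :
    'M[bool]_(nmon n k * nmon n k * nmon n k, nmon n (3 * k)) :=
  \matrix_(t, i) (mon (fst3 t) + mon (snd3 t) + mon (thd3 t) == mon i)%MM.

Definition bmx (A : pzRingType) p q (B : 'M[bool]_(p, q)) : 'M[A]_(p, q) :=
  map_mx (fun b : bool => b%:R) B.

(** Over the reals, the rows are the threefold products of the rows of [V], up to the multiplicities
    1, 3 and 6. Row freeness thus says that these products are linearly independent. *)
Definition cubic_mx (A : pzRingType) m n k (V : 'M[A]_(m, nmon n k)) :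
    'M[A]_(nmon m 3, nmon n (3 * k)) :=
  bmx A (sym3 m) *m tens3 V *m bmx A (mon3 n k).

Lemma map_bmx (A B : pzRingType) (f : {rmorphism A -> B}) p q
  (M : 'M[bool]_(p, q)) : map_mx f (bmx A M) = bmx B M.
Proof. by apply/matrixP => i j; rewrite !mxE rmorph_nat. Qed.

Lemma map_tens3 (A B : pzRingType) (f : {rmorphism A -> B}) p q
  (M : 'M[A]_(p, q)) : map_mx f (tens3 M) = tens3 (map_mx f M).
Proof. by rewrite /tens3 !map_mxT. Qed.

Lemma map_cubic_mx (A B : pzRingType) (f : {rmorphism A -> B}) m n k
  (M : 'M[A]_(m, nmon n k)) : map_mx f (cubic_mx M) = cubic_mx (map_mx f M).
Proof. by rewrite /cubic_mx !map_mxM !map_bmx map_tens3. Qed.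

Lemma mon_mem n k (i : 'I_(nmon n k)) : mdeg (mon i) = k.
Proof. by apply/eqP; rewrite -mem_monomials mem_nth. Qed.

Lemma monomials_uniq n k : uniq (monomials n k).
Proof. exact: uniq_basis. Qed.

Lemma mon_inj n k : injective (@mon n k).
Proof.
by move=> i j /eqP; rewrite nth_uniq ?monomials_uniq // => /eqP/val_inj.
Qed.

Lemma mon_surj n k (u : 'X_{1..n}) : mdeg u = k -> exists i : 'I_(nmon n k), mon i = u.
Proof.
move=> /eqP; rewrite -mem_monomials => h.
have lt_u : (index u (monomials n k) < nmon n k)%N by rewrite index_mem.
by exists (Ordinal lt_u); rewrite /mon nth_index.
Qed.

Lemma mdeg_cubic_mon m (t : 'I_(m * m * m)) : mdeg (cubic_mon t) = 3.
Proof. by rewrite /cubic_mon !mdegD !mdeg1. Qed.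

Lemma mdegS_sub m d (u : 'X_{1..m}) : mdeg u = d.+1 ->
  exists i (v : 'X_{1..m}), mdeg v = d /\ u = (U_(i) + v)%MM.
Proof.
move=> du; have : u != 0%MM by rewrite -mdeg_eq0 du.
move=> nz; have [i ui] : exists i, u i != 0%N.
  apply/existsP; apply: contraNT nz; rewrite negb_exists => /forallP h.
  by apply/eqP/mnmP => i; rewrite mnm0E; apply/eqP; have := h i; rewrite negbK.
have le : (U_(i) <= u)%MM.
  by apply/mnm_lepP => j; rewrite mnm1E; case: eqP => // <-; rewrite lt0n.
exists i, (u - U_(i))%MM; split; last by rewrite addmC submK.
by apply/eqP; rewrite -eqSS -du -{2}(submK le) mdegD mdeg1 addn1.
Qed.

Lemma cubic_mon_surj m (u : 'X_{1..m}) : mdeg u = 3 -> exists t, cubic_mon t = u.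
Proof.
case/mdegS_sub => a [v [/mdegS_sub [b [w [/mdegS_sub [c [z [/eqP]]]]]]]].
rewrite mdeg_eq0 => /eqP -> -> -> ->; exists (index3 a b c).
by rewrite /cubic_mon !index3K addm0 addmA.
Qed.

Lemma mnm1_inj m : injective (fun i : 'I_m => U_(i)%MM).
Proof.
move=> i j /(congr1 (fun u : 'X_{1..m} => u i)); rewrite !mnm1E eqxx.
by case: (eqVneq j i).
Qed.

Definition symmetric3 (A : Type) m (F : 'I_m -> 'I_m -> 'I_m -> A) :=
  forall a b c, F a b c = F b a c /\ F a b c = F a c b.

(** Triples with the same monomial are permutations of one another, and the two transpositions in
    [symmetric3] generate all permutations. The proof locates [a] among [a'], [b'], [c'] and cancels
    it. *)
Lemma symmetric3_cubic_mon (A : Type) m (F : 'I_m -> 'I_m -> 'I_m -> A) t u :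
  symmetric3 F -> cubic_mon t = cubic_mon u ->
  F (fst3 t) (snd3 t) (thd3 t) = F (fst3 u) (snd3 u) (thd3 u).
Proof.
move=> sF; rewrite /cubic_mon.
move: (fst3 t) (snd3 t) (thd3 t) (fst3 u) (snd3 u) (thd3 u) => a b c a' b' c'.
have s12 x y z : F x y z = F y x z by case: (sF x y z).
have s23 x y z : F x y z = F x z y by case: (sF x y z).
have two x b1 c1 b2 c2 : (U_(b1) + U_(c1) = U_(b2) + U_(c2) :> 'X_{1..m})%MM ->
    F x b1 c1 = F x b2 c2.
  move=> e; have := congr1 (fun u : 'X_{1..m} => u b1) e.
  rewrite !mnmDE !mnm1E eqxx; case: (eqVneq b2 b1) => [eb _|_].
    by move: e; rewrite eb => /addmI/mnm1_inj ->.
  case: (eqVneq c2 b1) => // ec _; move: e; rewrite ec [RHS]addmC => /addmI/mnm1_inj ->.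
  by rewrite s23.
move=> e; have := congr1 (fun u : 'X_{1..m} => u a) e.
rewrite !mnmDE !mnm1E eqxx.
case: (eqVneq a' a) => [ea _|_].
  by move: e; rewrite ea -!addmA => /addmI/two ->.
case: (eqVneq b' a) => [ea _|_].
  by move: e; rewrite ea [X in _ = (X + _)%MM]addmC -!addmA => /addmI/two ->; rewrite s12.
case: (eqVneq c' a) => [ea _|//].
move: e; rewrite ea [RHS]addmC -!addmA => /addmI/two ->.
by rewrite s12 s23.
Qed.

Lemma sym3_mulE (A : pzRingType) m (s : 'rV[A]_(nmon m 3)) i t :
  cubic_mon t = mon i -> (s *m bmx A (sym3 m)) 0 t = s 0 i.
Proof.
move=> ti; rewrite mxE (bigD1 i) //= !mxE ti eqxx mulr1 big1 ?addr0 // => j nj.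
by rewrite !mxE ti (inj_eq (@mon_inj _ _)) eq_sym (negPf nj) mulr0.
Qed.

Lemma sym3_symmetric (A : pzRingType) m (s : 'rV[A]_(nmon m 3)) :
  symmetric3 (fun a b c => (s *m bmx A (sym3 m)) 0 (index3 a b c)).
Proof.
have h t u : cubic_mon t = cubic_mon u ->
    (s *m bmx A (sym3 m)) 0 t = (s *m bmx A (sym3 m)) 0 u.
  have [i ti] := mon_surj (mdeg_cubic_mon t) => tu.
  by rewrite (sym3_mulE s (esym ti)) (sym3_mulE s (etrans (esym tu) (esym ti))).
move=> a b c; split; apply: h; rewrite /cubic_mon !index3K.
  by congr (_ + _)%MM; rewrite addmC.
by rewrite -!addmA; congr (_ + _)%MM; rewrite addmC.
Qed.

(** The coordinate at a cubic monomial is the entry of [y] at any triple representing it; symmetry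
    makes the choice irrelevant. *)
Lemma sym3_factor (A : pzRingType) m (y : 'rV[A]_(m * m * m)) :
  symmetric3 (fun a b c => y 0 (index3 a b c)) ->
  exists s, y = s *m bmx A (sym3 m).
Proof.
move=> sy.
have rep (i : 'I_(nmon m 3)) : {t | cubic_mon t == mon i}.
  by apply: sigW; have [t <-] := cubic_mon_surj (mon_mem i); exists t.
exists (\row_(i < nmon m 3) y 0 (sval (rep i))); apply/rowP => t.
have [i ti] := mon_surj (mdeg_cubic_mon t).
rewrite (sym3_mulE _ (esym ti)) mxE.
have e : cubic_mon t = cubic_mon (sval (rep i)).
  by rewrite -ti; apply/esym/eqP; case: (rep i).
by have /= := symmetric3_cubic_mon sy e; rewrite !index3_eta.
Qed.

Lemma sym3_inj (A : pzRingType) m (s : 'rV[A]_(nmon m 3)) :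
  s *m bmx A (sym3 m) = 0 -> s = 0.
Proof.
move=> s0; apply/rowP => i; rewrite mxE.
have [t ti] := cubic_mon_surj (mon_mem i).
by rewrite -(sym3_mulE s ti) s0 mxE.
Qed.

Lemma tens3_symmetric (A : comPzRingType) p q (y : 'rV[A]_(p * p * p))
    (B : 'M[A]_(p, q)) :
  symmetric3 (fun a b c => y 0 (index3 a b c)) ->
  symmetric3 (fun a b c => (y *m tens3 B) 0 (index3 a b c)).
Proof.
move=> sy a b c; rewrite !mxE !sum_index3; split.
  rewrite exchange_big /=; apply: eq_bigr => i _; apply: eq_bigr => j _.
  apply: eq_bigr => l _; rewrite !tens3E !index3K (sy j i l).1.
  by congr (_ * (_ * _)); rewrite mulrC.
apply: eq_bigr => i _; rewrite exchange_big /=; apply: eq_bigr => j _.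
apply: eq_bigr => l _; rewrite !tens3E !index3K (sy i l j).2.
by rewrite -!mulrA; congr (_ * (_ * _)); rewrite mulrC.
Qed.

(* [cubic_mx C] is row free exactly when [tens3 C *m mon3] is injective on symmetric tensors, and
   multiplication by [tens3 B] preserves symmetry. *)
Lemma cubic_mx_row_free (F : fieldType) m p n k (B : 'M[F]_(m, p))
    (B' : 'M[F]_(p, m)) (C : 'M[F]_(p, nmon n k)) :
  B *m B' = 1%:M -> row_free (cubic_mx C) -> row_free (cubic_mx (B *m C)).
Proof.
move=> BB' fC; rewrite -kermx_eq0; apply/eqP/row_matrixP => i.
rewrite row0; set s := row i _.
have s0 : s *m cubic_mx (B *m C) = 0.
  by rewrite /s -row_mul mulmx_ker row0.
have [s' es'] := sym3_factor (tens3_symmetric B (sym3_symmetric s)).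
have s'0 : s' = 0.
  apply: (row_free_inj fC); rewrite mul0mx -s0 /cubic_mx tens3_mul !mulmxA.
  by rewrite es'.
(* [tens3 B'] is a right inverse of [tens3 B], so [s' = 0] makes the tensor of [s] vanish. *)
apply: sym3_inj; rewrite -[LHS]mulmx1 -tens3_1 -BB' tens3_mul mulmxA es' s'0.
by rewrite !mul0mx.
Qed.

(** * Forms and their coefficients *)

Section CoefficientVectors.
Variables (R : realType) (n : nat).
Implicit Types (k d : nat) (f : {mpoly R[n]}).

Lemma coefs_sum k (I : finType) (c : I -> R) (f : I -> {mpoly R[n]}) :
  coefs k (\sum_i c i *: f i) = \sum_i c i *: coefs k (f i).
Proof.
apply/rowP => j; rewrite mxE raddf_sum summxE; apply: eq_bigr => i _ /=.
by rewrite !mxE mcoeffZ.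
Qed.

Lemma coefs_inj d f : f \is d.-homog -> coefs d f = 0 -> f = 0.
Proof.
move=> hf f0; apply/mpolyP => u; rewrite mcoeff0.
case: (mdeg u =P d) => [/mon_surj [i <-]|/eqP du].
  by have /rowP/(_ i) := f0; rewrite !mxE.
by rewrite (dhomog_nemf_coeff hf).
Qed.

Lemma form_of_homog k (c : 'rV[R]_(nmon n k)) : form_of c \is k.-homog.
Proof.
apply: rpred_sum => j _; apply: rpredZ; rewrite dhomogX; exact/eqP/mon_mem.
Qed.

Lemma coefs_form_of k (c : 'rV[R]_(nmon n k)) : coefs k (form_of c) = c.
Proof.
apply/rowP => j; rewrite mxE raddf_sum (bigD1 j) //= mcoeffZ mcoeffX eqxx mulr1.
rewrite big1 ?addr0 // => i ij.
by rewrite mcoeffZ mcoeffX (inj_eq (@mon_inj _ _)) (negPf ij) mulr0.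
Qed.

Lemma form_ofK k f : f \is k.-homog -> form_of (coefs k f) = f.
Proof.
move=> hf; apply/eqP; rewrite -subr_eq0; apply/eqP/(@coefs_inj k).
  by rewrite rpredB ?form_of_homog.
apply/rowP => j; have /rowP/(_ j) := coefs_form_of (coefs k f).
by rewrite !mxE mcoeffB => ->; rewrite subrr.
Qed.

Lemma form_of_mulmx k p (c : 'rV[R]_p) (V : 'M[R]_(p, nmon n k)) :
  form_of (c *m V) = \sum_i c 0 i *: form_of (row i V).
Proof.
rewrite /form_of; transitivity
  (\sum_j \sum_i c 0 i *: (row i V 0 j *: 'X_[mon j]) : {mpoly R[n]}).
  apply: eq_bigr => j _; rewrite mxE scaler_suml.
  by apply: eq_bigr => i _; rewrite mxE scalerA.
by rewrite exchange_big; apply: eq_bigr => i _; rewrite scaler_sumr.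
Qed.

Lemma row_coefs_family k m (q : 'I_m -> {mpoly R[n]}) i :
  row i (coefs_family k q) = coefs k (q i).
Proof. by apply/rowP => j; rewrite !mxE. Qed.

Lemma form_of_mul3 k (x y z : 'rV[R]_(nmon n k)) :
  form_of x * form_of y * form_of z =
  \sum_t (x 0 (fst3 t) * y 0 (snd3 t) * z 0 (thd3 t)) *:
    'X_[(mon (fst3 t) + mon (snd3 t) + mon (thd3 t))%MM].
Proof.
rewrite sum_index3 /form_of big_distrlr /= big_distrl; apply: eq_bigr => a _ /=.
rewrite big_distrl; apply: eq_bigr => b _ /=.
rewrite big_distrr; apply: eq_bigr => c _ /=; rewrite !index3K.
by rewrite -!scalerAl -!scalerAr -scalerAl !scalerA !mpolyXD mulrAC.
Qed.

Lemma coefs_mul3 k m (V : 'M[R]_(m, nmon n k)) t :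
  coefs (3 * k) (form_of (row (fst3 t) V) * form_of (row (snd3 t) V)
                 * form_of (row (thd3 t) V)) =
  row t (tens3 V *m bmx R (mon3 n k)).
Proof.
apply/rowP => j; rewrite form_of_mul3 mxE raddf_sum !mxE; apply: eq_bigr => u _.
by rewrite /= mcoeffZ mcoeffX tens3E !mxE.
Qed.

Lemma coefs_cubic k m (V : 'M[R]_(m, nmon n k)) (y : 'rV[R]_(m * m * m)) :
  coefs (3 * k) (\sum_t y 0 t *: (form_of (row (fst3 t) V)
     * form_of (row (snd3 t) V) * form_of (row (thd3 t) V))) =
  y *m tens3 V *m bmx R (mon3 n k).
Proof.
rewrite coefs_sum -mulmxA mulmx_sum_row; apply: eq_bigr => t _.
by rewrite coefs_mul3.
Qed.

(** A vector of the left kernel yields, up to multiplicities, the coefficients of a homogeneous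
    cubic relation between the [q i]. *)
Lemma no_cubic_relation_row_free k m (q : 'I_m -> {mpoly R[n]}) :
  (forall i, q i \is k.-homog) -> no_cubic_relation q ->
  row_free (cubic_mx (coefs_family k q)).
Proof.
move=> hq free_q; rewrite -kermx_eq0; apply/eqP/row_matrixP => i.
rewrite row0; set s := row i _; set C := coefs_family k q.
have s0 : s *m cubic_mx C = 0 by rewrite /s -row_mul mulmx_ker row0.
pose y := s *m bmx R (sym3 m).
pose f : {mpoly R[m]} := \sum_t y 0 t *: 'X_[cubic_mon t].
have qE a : form_of (row a C) = q a by rewrite row_coefs_family form_ofK.
have f0 : f = 0.
  apply: free_q.
    apply: leq_trans (msize_sum _ _ _) _; apply/bigmax_leqP => t _.
    by apply: leq_trans (msizeZ_le _ _) _; rewrite msizeX mdeg_cubic_mon.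
  have -> : f \mPo [tuple q i | i < m] =
      \sum_t y 0 t *: (form_of (row (fst3 t) C) * form_of (row (snd3 t) C)
                       * form_of (row (thd3 t) C)).
    rewrite raddf_sum; apply: eq_bigr => t _ /=.
    rewrite comp_mpolyZ /cubic_mon !mpolyXD !rmorphM /=.
    by rewrite !comp_mpolyXU -!tnth_nth !tnth_mktuple !qE.
  apply: (@coefs_inj (3 * k)).
    apply: rpred_sum => t _; apply: rpredZ.
    rewrite (_ : 3 * k = k + k + k)%N; last by rewrite !mulSn mul0n addn0 addnA.
    by rewrite !dhomogM ?form_of_homog.
  by rewrite coefs_cubic /y -s0 /cubic_mx !mulmxA.
apply/rowP => j; rewrite [RHS]mxE.
have := congr1 (mcoeff (mon j)) f0; rewrite raddf_sum mcoeff0 /=.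
(* Each triple with monomial [mon j] contributes [s 0 j]. There is at least one such triple, so the
   multiplicity is nonzero in characteristic zero. *)
have -> : \sum_t (y 0 t *: 'X_[cubic_mon t])@_(mon j) =
    s 0 j * (#|[pred t | cubic_mon t == mon j]|)%:R.
  rewrite -sum1_card natr_sum mulr_sumr [RHS]big_mkcond; apply: eq_bigr => t _ /=.
  rewrite mcoeffZ mcoeffX inE.
  by case: eqP => [/sym3_mulE <-|]; rewrite ?mulr1 ?mulr0.
move/eqP; rewrite mulf_eq0 pnatr_eq0 => /orP[/eqP //|/eqP/card0_eq e].
by have [t tj] := cubic_mon_surj (mon_mem j); have := e t; rewrite inE tj eqxx.
Qed.

Definition gram_form k (X : 'M[R]_(nmon n k)) : {mpoly R[n]} :=
  \sum_a \sum_b X a b *: 'X_[(mon a + mon b)%MM].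

Lemma gram_form_homog k (X : 'M[R]_(nmon n k)) :
  gram_form X \is (2 * k).-homog.
Proof.
apply: rpred_sum => a _; apply: rpred_sum => b _; apply: rpredZ.
by rewrite dhomogX; apply/eqP; rewrite [LHS]mdegD !mon_mem mulSn mul1n.
Qed.

Lemma gram_form_sos k p (V : 'M[R]_(p, nmon n k)) :
  gram_form (V^T *m V) = \sum_i form_of (row i V) ^+ 2.
Proof.
transitivity (\sum_a \sum_b \sum_i
   (V i a * V i b) *: 'X_[(mon a + mon b)%MM] : {mpoly R[n]}).
  apply: eq_bigr => a _; apply: eq_bigr => b _; rewrite mxE scaler_suml.
  by apply: eq_bigr => i _; rewrite mxE.
under eq_bigr do rewrite exchange_big; rewrite exchange_big /=.
apply: eq_bigr => i _; rewrite expr2 /form_of big_distrlr /=.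
apply: eq_bigr => a _; apply: eq_bigr => b _.
by rewrite -scalerAl -scalerAr scalerA mpolyXD !mxE.
Qed.

(** The rows of [V] and of [W] give two representations of equal length, so [V = O *m W] with [O]
    orthogonal, and [O] cancels in the Gram matrix. *)
Lemma uniquely_sos_gram k p (V W : 'M[R]_(p, nmon n k)) f :
  uniquely_sos k f -> f = gram_form (V^T *m V) -> f = gram_form (W^T *m W) ->
  V^T *m V = W^T *m W.
Proof.
move=> [_ uniq_f] fV fW.
have rep (U : 'M[R]_(p, nmon n k)) : f = gram_form (U^T *m U) ->
    sos_rep k f (fun i => form_of (row i U)).
  by move=> ->; split; [move=> i; apply: form_of_homog | rewrite gram_form_sos].
have [O OO VW] := uniq_f _ _ _ (rep _ fW) (rep _ fV).
suff -> : V = O *m W.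
  by rewrite trmx_mul mulmxA -(mulmxA _ O^T) (mulmx1C OO) mulmx1.
apply/row_matrixP => i.
rewrite -[LHS]coefs_form_of -[RHS]coefs_form_of VW row_mul form_of_mulmx.
by congr (coefs k _); apply: eq_bigr => j _; rewrite mxE.
Qed.

End CoefficientVectors.

(** Comparison of coefficients in $[X]_k^T G [X]_k = f$, as linear conditions on $G$. *)
Definition gram_constraints (n k : nat) :
    'M[bool]_(nmon n (2 * k), nmon n k * nmon n k) :=
  \matrix_i mxvec (\matrix_(a, b) (mon a + mon b == mon i)%MM).

Lemma gram_constraintsE (R : realType) n k (X : 'M[R]_(nmon n k)) :
  bmx R (gram_constraints n k) *m (mxvec X)^T = (coefs (2 * k) (gram_form X))^T.
Proof.
apply/colP => i; rewrite !mxE raddf_sum /= (reindex _ (curry_mxvec_bij _ _)) /=.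
transitivity (\sum_a \sum_b X a b * (mon a + mon b == mon i)%MM%:R).
  by rewrite pair_bigA; apply: eq_bigr => -[a b] _ /=; rewrite !mxE !mxvecE mxE mulrC.
apply: eq_bigr => a _; rewrite raddf_sum; apply: eq_bigr => b _ /=.
by rewrite mcoeffZ mcoeffX.
Qed.

(** * Spectral decompositions *)

Section Spectral.
Variable R : realType.

Lemma mulmx_tr_ge0 p q (S : 'M[R]_(p, q)) (v : 'rV[R]_q) :
  0 <= (v *m (S^T *m S) *m v^T) 0 0.
Proof.
have e : S *m v^T = (v *m S^T)^T by rewrite trmx_mul trmxK.
rewrite mulmxA -mulmxA e mxE.
by apply: sumr_ge0 => i _; rewrite [(v *m _)^T _ _]mxE -expr2 sqr_ge0.
Qed.

Lemma psd_mulmx_tr p q (S : 'M[R]_(p, q)) : psd (S^T *m S).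
Proof. by split; [rewrite trmx_mul trmxK | move=> v; apply: mulmx_tr_ge0]. Qed.

Lemma psd_eig_ge0 N (P : 'M[R]_N) (d : 'rV[R]_N) :
  P *m P^T = 1%:M -> psd (P^T *m diag_mx d *m P) -> forall i, 0 <= d 0 i.
Proof.
(* The test vector is the [i]-th eigenvector, at which the quadratic form takes the value
   [d 0 i]. *)
move=> PP [_ h] i; have := h (delta_mx 0 i *m P).
rewrite trmx_mul !mulmxA -(mulmxA _ P P^T) PP mulmx1 -(mulmxA _ P P^T) PP mulmx1.
by rewrite -rowE trmx_delta -colE !mxE eqxx mulr1n.
Qed.

Lemma diag_sqrt_sq N (P : 'M[R]_N) (d : 'rV[R]_N) :
  (forall i, 0 <= d 0 i) ->
  (diag_mx (map_mx Num.sqrt d) *m P)^T *m (diag_mx (map_mx Num.sqrt d) *m P) =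
  P^T *m diag_mx d *m P.
Proof.
move=> d0; rewrite trmx_mul tr_diag_mx !mulmxA -(mulmxA P^T (diag_mx (map_mx _ _))) mulmx_diag.
congr (_ *m diag_mx _ *m _); apply/rowP => i.
by rewrite !mxE -expr2 sqr_sqrtr.
Qed.

(** [S^T *m S] has rank at most [m]. The eigenvalues being nonnegative and sorted, a nonzero one at
    a position [j >= m] would make the first [m + 1] of them nonzero. *)
Lemma eig_tail_eq0 N m (P : 'M[R]_N) (d : 'rV[R]_N) (S : 'M[R]_(m, N)) :
  P *m P^T = 1%:M -> P^T *m diag_mx d *m P = S^T *m S ->
  (forall i, 0 <= d 0 i) -> (forall i j : 'I_N, (i <= j)%N -> d 0 j <= d 0 i) ->
  forall j : 'I_N, (m <= j)%N -> d 0 j = 0.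
Proof.
move=> PP PdP d0 dS j mj; apply/eqP; apply: contraT => dj.
have dpos (i : 'I_N) : (i <= j)%N -> d 0 i != 0.
  by move=> /dS h; rewrite gt_eqF // (lt_le_trans _ h) // lt_def dj d0.
have mN : (m < N)%N by apply: leq_ltn_trans mj (ltn_ord j).
pose w := widen_ord mN.
(* [E] extracts the first [m + 1] coordinates. The compressed diagonal matrix is invertible, yet by
   [eD] it factors through dimension [m]. *)
pose E : 'M[R]_(m.+1, N) := \matrix_(i, l) (l == w i)%:R.
have winj : injective w by move=> a b /(congr1 val) /= /val_inj.
have ED : E *m diag_mx d *m E^T = diag_mx (\row_i d 0 (w i)).
  apply/matrixP => a b; rewrite !mxE (bigD1 (w a)) //= big1 ?addr0.
    rewrite mul_mx_diag !mxE eqxx mul1r.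
    by rewrite (inj_eq winj) eq_sym mulr_natr.
  by move=> l la; rewrite mul_mx_diag !mxE (negPf la) !mul0r.
have : \rank (E *m diag_mx d *m E^T) = m.+1.
  apply/eqP; rewrite -[_ == _]/(row_free _) row_free_unit ED unitmxE det_diag unitfE.
  by apply/prodf_neq0 => i _; rewrite mxE dpos // (leq_trans _ mj) //= -ltnS.
pose T := S *m P^T.
have eD : diag_mx d = T^T *m T.
  rewrite /T trmx_mul trmxK mulmxA -(mulmxA P) -PdP !mulmxA PP mul1mx.
  by rewrite -mulmxA PP mulmx1.
move=> rk; have : (\rank (E *m diag_mx d *m E^T) <= m)%N.
  rewrite eD mulmxA -(mulmxA (E *m _)).
  exact: mulmx_max_rank.
by rewrite rk ltnn.
Qed.

(** Truncating the spectral square root to [m] rows is exact, because the eigenvalues cut off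
    vanish. *)
Lemma sqrt_eig_top N m (P : 'M[R]_N) (d : 'rV[R]_N) (S : 'M[R]_(m, N)) :
  (m <= N)%N -> P *m P^T = 1%:M -> P^T *m diag_mx d *m P = S^T *m S ->
  (forall i j : 'I_N, (i <= j)%N -> d 0 j <= d 0 i) ->
  let V := pid_mx m *m diag_mx (map_mx Num.sqrt d) *m P : 'M[R]_(m, N) in
  V^T *m V = S^T *m S.
Proof.
move=> mN PP PdP dS V.
have d0 : forall i, 0 <= d 0 i.
  by apply: (psd_eig_ge0 PP); rewrite PdP; apply: psd_mulmx_tr.
have dt := eig_tail_eq0 PP PdP d0 dS.
rewrite -PdP; set D := diag_mx _ in V *.
have -> : V^T *m V = P^T *m (D *m (pid_mx m : 'M_(m, N))^T *m pid_mx m *m D) *m P.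
  by rewrite /V !trmx_mul tr_diag_mx !mulmxA.
congr (_ *m _ *m _); rewrite tr_pid_mx -(mulmxA D) pid_mx_id //.
apply/matrixP => i j; rewrite mul_mx_diag mul_diag_mx !mxE.
have -> : (i == j :> nat) = (i == j) by [].
case: (eqVneq i j) => [<-|_]; last by rewrite mulr0 mul0r.
case: (ltnP i m) => [_|/dt ->]; first by rewrite /= mulr1 -expr2 sqr_sqrtr.
by rewrite sqrtr0 mulr0.
Qed.

Lemma orthogonal_factor N m (V S : 'M[R]_(m, N)) :
  row_free S -> V^T *m V = S^T *m S ->
  exists2 O : 'M[R]_m, O *m O^T = 1%:M & V = O *m S.
Proof.
case/row_freeP => T ST VS; pose O := V *m T.
have OO : O^T *m O = 1%:M.
  rewrite /O trmx_mul mulmxA -(mulmxA T^T) VS mulmxA -(mulmxA _ S T) ST mulmx1.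
  by rewrite -trmx_mul ST trmx1.
exists O; first exact: mulmx1C.
(* [O^T V = T^T V^T V = T^T S^T S = S], as [T] is a right inverse of [S]. *)
have -> : S = O^T *m V.
  rewrite /O trmx_mul -mulmxA VS mulmxA -trmx_mul ST trmx1 mul1mx //.
by rewrite mulmxA (mulmx1C OO) mul1mx.
Qed.

(** Entrywise, [diag_mx d *m W = W *m diag_mx D] says that [W i j] is nonzero only if
    [d 0 i = D 0 j]. As the entries of [D] are distinct, each row of [W] has a single nonzero entry,
    and orthogonality makes [W] a signed permutation matrix. *)
Lemma orthogonal_diag m (W : 'M[R]_m) (d D : 'rV[R]_m) :
  injective (D 0) -> W *m W^T = 1%:M -> W *m diag_mx D *m W^T = diag_mx d ->
  exists s : 'I_m -> 'I_m,
    [/\ bijective s, forall i, W i (s i) ^+ 2 = 1,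
        forall i j, j != s i -> W i j = 0 & forall i, d 0 i = D 0 (s i)].
Proof.
move=> injD WW Wd.
have comm i j : d 0 i * W i j = W i j * D 0 j.
  have /matrixP/(_ i j) : diag_mx d *m W = W *m diag_mx D.
    by rewrite -Wd -!mulmxA (mulmx1C WW) mulmx1.
  by rewrite mul_diag_mx mul_mx_diag !mxE.
have eig i j : W i j != 0 -> d 0 i = D 0 j.
  by move=> nz; apply: (mulIf nz); rewrite comm mulrC.
have ex i : {j | W i j != 0}.
  apply: sigW; apply/existsP; apply: contraT; rewrite negb_exists => /forallP h.
  have /matrixP/(_ i i) := WW; rewrite !mxE eqxx big1 => [/eqP|j _].
    by rewrite eq_sym oner_eq0.
  by have := h j; rewrite negbK => /eqP ->; rewrite mul0r.
pose s i := sval (ex i).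
have sP i : W i (s i) != 0 := svalP (ex i).
have s0 i j : j != s i -> W i j = 0.
  move=> js; apply/eqP; apply: contraT => /eig e.
  by rewrite (eig _ _ (sP i)) in e; rewrite (injD _ _ e) eqxx in js.
have dot i i' : \sum_j W i j * W i' j = (i == i')%:R.
  have /matrixP/(_ i i') := WW; rewrite !mxE => <-.
  by apply: eq_bigr => j _; rewrite mxE.
exists s; split => //.
(* Two rows with their nonzero entries in the same column could not be orthogonal. *)
- apply: injF_bij => i i' e; apply/eqP; apply: contraT => ne.
  have := dot i i'; rewrite (negPf ne) (bigD1 (s i)) //= big1 => [|j /s0 ->].
    by move=> /eqP; rewrite addr0 mulf_eq0 (negPf (sP i)) e (negPf (sP i')).
  by rewrite mul0r.
- move=> i; have := dot i i; rewrite eqxx (bigD1 (s i)) //= big1 => [|j /s0 ->].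
    by rewrite addr0 -expr2.
  by rewrite mul0r.
- by move=> i; apply: eig.
Qed.
End Spectral.

(** * The algorithm *)

(** A linear relation [v] gives the symmetric tensor [tens3 v], whose product with [tens3 C] is
    [tens3 (v *m C) = 0]. Row freeness kills this tensor, and its diagonal entries are the cubes of
    the entries of [v]. *)
Lemma cubic_mx_row_free_forms (F : fieldType) m n k (C : 'M[F]_(m, nmon n k)) :
  row_free (cubic_mx C) -> row_free C.
Proof.
move=> fC; rewrite -kermx_eq0; apply/eqP/row_matrixP => i.
rewrite row0; set v := row i _.
have v0 : v *m C = 0 by rewrite /v -row_mul mulmx_ker row0.
pose y := row (index3 0 0 0) (tens3 v).
have yE a b c : y 0 (index3 a b c) = v 0 a * v 0 b * v 0 c.
  by rewrite [LHS]mxE tens3E !index3K.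
have [a b c|s ys] := @sym3_factor _ _ y.
  by rewrite !yE; split; [rewrite (mulrC (v 0 a)) | rewrite -!mulrA (mulrC (v 0 b))].
have s0 : s = 0.
  apply: (row_free_inj fC); rewrite mul0mx /cubic_mx !mulmxA -ys -row_mul.
  rewrite -tens3_mul v0; apply/rowP => j; rewrite !mxE big1 // => t _.
  by rewrite mxE tens3E !mxE !mul0r.
apply/rowP => a; have /rowP/(_ (index3 a a a)) := ys.
rewrite s0 mul0mx yE !mxE => /eqP; rewrite !mulf_eq0 -!orbA.
by case/or3P => /eqP.
Qed.

Definition weighted_tensor (A : pzRingType) m p (lam : 'I_m -> A)
    (B : 'M[A]_(m, p)) : 'rV[A]_(p * p * p) :=
  \sum_i lam i *: row (index3 i i i) (tens3 B).

Lemma weighted_tensorE (A : pzRingType) m p (lam : 'I_m -> A) (B : 'M[A]_(m, p)) a b c :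
  weighted_tensor lam B 0 (index3 a b c) =
  \sum_i lam i * (B i a * B i b * B i c).
Proof.
rewrite summxE; apply: eq_bigr => i _.
by rewrite mxE [row _ _ _ _]mxE tens3E !index3K.
Qed.

Lemma weighted_tensor_symmetric (A : comPzRingType) m p (lam : 'I_m -> A)
    (B : 'M[A]_(m, p)) :
  symmetric3 (fun a b c => weighted_tensor lam B 0 (index3 a b c)).
Proof.
move=> a b c; rewrite !weighted_tensorE.
split; apply: eq_bigr => i _; congr (_ * _); first by rewrite (mulrC (B i a)).
by rewrite -!mulrA (mulrC (B i b)).
Qed.

(** When [B *m V] is the matrix of the [q i], this exhibits [f3] as the image of a symmetric tensor,
    which [solve_cubic] then recovers. *)
Lemma coefs_weighted_cubes (R : realType) n k m p (lam : 'I_m -> R)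
    (B : 'M[R]_(m, p)) (V : 'M[R]_(p, nmon n k)) :
  coefs (3 * k) (\sum_i lam i *: form_of (row i (B *m V)) ^+ 3) =
  weighted_tensor lam B *m tens3 V *m bmx R (mon3 n k).
Proof.
rewrite coefs_sum !mulmx_suml; apply: eq_bigr => i _.
have := coefs_mul3 (B *m V) (index3 i i i); rewrite !index3K => e.
rewrite exprS expr2 mulrA e tens3_mul -!scalemxAl !row_mul.
by [].
Qed.

(** The symmetric [y] has coordinates [s], so the data equal [s *m cubic_mx V]. Row freeness makes
    [s] the only solution, hence the one that [pinvmx] returns. *)
Lemma solve_cubic (F : fieldType) n k m (V : 'M[F]_(m, nmon n k))
    (y : 'rV[F]_(m * m * m)) :
  row_free (cubic_mx V) -> symmetric3 (fun a b c => y 0 (index3 a b c)) ->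
  y *m tens3 V *m bmx F (mon3 n k) *m pinvmx (cubic_mx V) *m bmx F (sym3 m) = y.
Proof.
move=> fV /sym3_factor[s ys].
have e : y *m tens3 V *m bmx F (mon3 n k) = s *m cubic_mx V.
  by rewrite ys /cubic_mx !mulmxA.
rewrite [RHS]ys; congr (_ *m _); apply: (row_free_inj fV).
by rewrite e mulmxKpV ?submxMl.
Qed.

(** The index is compared as a natural number because [nmon n k] may be zero. *)
Definition lead_mon (n k : nat) : 'M[bool]_(nmon n k, 1) :=
  \matrix_(j, _) (j == 0 :> nat).

Definition lead_coefs (A : pzRingType) m n k (V : 'M[A]_(m, nmon n k)) : 'cV[A]_m :=
  V *m bmx A (lead_mon n k).

(** With [select_rest], this contracts a tensor with a vector by matrix and entrywise products only:
    the one spreads the vector along the first index, the other sums that index out. *)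
Definition select_fst m : 'M[bool]_(m, m * m * m) :=
  \matrix_(a, t) (fst3 t == a).

Definition select_rest m : 'M[bool]_(m * m * m, m * m) :=
  \matrix_t mxvec (\matrix_(b, c) ((snd3 t == b) && (thd3 t == c))).

(** For a row [b], contracting the first slot of its tensor cube with [v] gives the scalar [b v]
    times the rank-one matrix [b^T b]. *)
Lemma contract_weighted_tensor (A : comPzRingType) m p (lam : 'I_m -> A)
    (B : 'M[A]_(m, p)) (v : 'cV[A]_p) :
  vec_mx (map2_mx *%R (weighted_tensor lam B) (v^T *m bmx A (select_fst p))
          *m bmx A (select_rest p)) =
  B^T *m diag_mx (\row_i (lam i * (B *m v) i 0)) *m B.
Proof.
apply/matrixP => b c; rewrite !mxE sum_index3.
transitivity (\sum_a weighted_tensor lam B 0 (index3 a b c) * v a 0).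
  apply: eq_bigr => a _; rewrite (bigD1 b) //= (bigD1 c) //= !big1 ?addr0.
  - rewrite !mxE mxvecE mxE !index3K !eqxx mulr1; congr (_ * _).
    rewrite (bigD1 a) //= !mxE index3K eqxx mulr1 big1 ?addr0 // => i ia.
    by rewrite !mxE index3K eq_sym (negPf ia) mulr0.
  - move=> b' bb; rewrite big1 // => c' _.
    by rewrite !mxE mxvecE mxE !index3K (negPf bb) mulr0.
  - by move=> c' cc; rewrite !mxE mxvecE mxE !index3K (negPf cc) andbF mulr0.
under eq_bigr do rewrite weighted_tensorE mulr_suml.
rewrite exchange_big /=; apply: eq_bigr => i _.
rewrite mul_mx_diag !mxE mulr_sumr mulr_sumr mulr_suml; apply: eq_bigr => a _.
rewrite -!mulrA (mulrC (B i c)) [RHS]mulrCA; congr (_ * _).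
exact: mulrCA.
Qed.

Section Program.
Variables n m k : nat.
Local Notation N := (nmon n k).

(** The objective is zero, so every feasible matrix is optimal; uniqueness of the representation
    leaves only one. *)
Definition gram_prog : prog N N :=
  Sdp (Const (const_mx false)) (Const (gram_constraints n k))
      (Var 1 (nmon n (2 * k)) 0).

Definition diag_prog s (d : prog 1 s) : prog s s :=
  Had (Const (\matrix_(i, j) (i == j))) (Mul (Const (const_mx true)) d).

Definition basis_prog : prog m N :=
  Mul (Mul (Const (\matrix_(i, j) (i == j :> nat)))
           (diag_prog (Sqrt (EigVal gram_prog))))
      (EigVec gram_prog).

(** Inflates [a] along one slot of the triple indices; the entrywise product of the three inflations
    is the Kronecker cube. *)
Definition select_prog p q (f : forall s, 'I_(s * s * s) -> 'I_s)
    (a : prog p q) : prog (p * p * p) (q * q * q) :=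
  Mul (Mul (Const (\matrix_(t, i) (f p t == i))) a)
      (Const (\matrix_(j, u) (f q u == j))).

Definition tens3_prog p q (a : prog p q) : prog (p * p * p) (q * q * q) :=
  Had (Had (select_prog fst3 a) (select_prog snd3 a)) (select_prog thd3 a).

Definition cubic_prog : prog (nmon m 3) (nmon n (3 * k)) :=
  Mul (Mul (Const (sym3 m)) (tens3_prog basis_prog)) (Const (mon3 n k)).

Definition tensor_prog : prog 1 (m * m * m) :=
  Mul (Solve cubic_prog (Var 1 (nmon n (3 * k)) 1)) (Const (sym3 m)).

(* Its eigenvalues are the coefficients of the [q i] at the first monomial. *)
Definition contraction_prog : prog m m :=
  Unvec (Mul (Had tensor_prog
                  (Mul (Tr (Mul basis_prog (Const (lead_mon n k))))
                       (Const (select_fst m))))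
             (Const (select_rest m))).

Definition powers_prog : prog m N := Mul (EigVec contraction_prog) basis_prog.

(* The rows of [powers_prog] are the forms [sqrt (lam i) *: q i] up to sign, so the quotient of an
   eigenvalue by the corresponding first coefficient is [(sqrt (lam i))^-1] up to the same sign. *)
Definition ratio_prog : prog m 1 :=
  Had (Tr (EigVal contraction_prog))
      (Inv (Mul powers_prog (Const (lead_mon n k)))).

(** Multiplying by the ratios removes both sign and [sqrt (lam i)] from the forms, and the inverse
    squares of the ratios are the weights. The two constants place these results in the first [N]
    columns and in the last one. *)
Definition recovery_prog : prog m (N + 1) :=
  Add (Mul (Had powers_prog (Mul ratio_prog (Const (const_mx true))))
           (Const (\matrix_(i, j) (i == j :> nat))))
      (Mul (Had (Inv ratio_prog) (Inv ratio_prog))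
           (Const (\matrix_(i, j) (j == N :> nat)))).

End Program.

(** * Evaluation of the subprograms *)

Section Evaluation.
Variables (R : realType) (sdp : sdp_solver R) (eig : eig_solver R) (E : env R).
Local Notation ev := (eval sdp eig E).

Lemma eval_MulE p q r (a : prog p q) (b : prog q r) :
  ev (Mul a b) = ev a *m ev b.
Proof. by []. Qed.

Lemma eval_HadE p q (a b : prog p q) i j :
  ev (Had a b) i j = ev a i j * ev b i j.
Proof. by rewrite /= mxE. Qed.

Lemma eval_diag_prog s (d : prog 1 s) : ev (diag_prog d) = diag_mx (ev d).
Proof.
apply/matrixP => i j; rewrite !mxE big_ord1 !mxE mul1r mulr_natl.
by case: eqVneq => // ->.
Qed.

Lemma eval_select_prog p q f (a : prog p q) t u :
  ev (select_prog f a) t u = ev a (f p t) (f q u).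
Proof.
rewrite mxE (bigD1 (f q u)) //= big1 => [|j ju]; last first.
  by rewrite !mxE eq_sym (negPf ju) mulr0.
rewrite !mxE eqxx mulr1 addr0 (bigD1 (f p t)) //= big1 => [|i it]; last first.
  by rewrite !mxE eq_sym (negPf it) mul0r.
by rewrite !mxE eqxx mul1r addr0.
Qed.

Lemma eval_tens3_prog p q (a : prog p q) : ev (tens3_prog a) = tens3 (ev a).
Proof.
by apply/matrixP => t u; rewrite tens3E /tens3_prog !eval_HadE !eval_select_prog.
Qed.

Lemma eval_cubic_prog n m k :
  ev (cubic_prog n m k) = cubic_mx (ev (basis_prog n m k)).
Proof. by rewrite /cubic_prog !eval_MulE eval_tens3_prog. Qed.

End Evaluation.

Lemma weighted_powers_homog (R : realType) n k m d (lam : 'I_m -> R)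
    (q : 'I_m -> {mpoly R[n]}) :
  (forall i, q i \is k.-homog) -> weighted_powers lam q d \is (d * k).-homog.
Proof.
move=> hq; apply: rpred_sum => i _; apply: rpredZ.
elim: d => [|d IH]; first by rewrite mul0n expr0 dhomog1.
by rewrite exprS mulSn dhomogM.
Qed.

(** * Correctness of the recovery *)

Section Correctness.
Variables (R : realType) (sdp : sdp_solver R) (eig : eig_solver R).
Hypotheses (sdpP : sdp_correct sdp) (eigP : eig_correct eig).
Variables (n m k : nat) (q : 'I_m -> {mpoly R[n]}) (lam : 'I_m -> R).
Hypotheses (q_homog : forall i, q i \is k.-homog) (lam_gt0 : forall i, 0 < lam i).

Local Notation N := (nmon n k).
Local Notation C := (coefs_family k q).
Local Notation f2 := (weighted_powers lam q 2).
Local Notation f3 := (weighted_powers lam q 3).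
Local Notation ev := (eval sdp eig (input_env k f2 f3)).

Hypotheses (f2_unique : uniquely_sos k f2) (C_free : row_free (cubic_mx C)).
Hypotheses (lead_neq0 : forall i, lead_coefs C i 0 != 0)
           (lead_inj : injective (fun i => lead_coefs C i 0)).

Let sl : 'rV[R]_m := \row_i Num.sqrt (lam i).
Let S : 'M[R]_(m, N) := diag_mx sl *m C.

Lemma sqrt_lam_neq0 i : sl 0 i != 0.
Proof. by rewrite mxE gt_eqF // sqrtr_gt0. Qed.

Lemma sqrt_lam_inv : diag_mx (map_mx GRing.inv sl) *m diag_mx sl = 1%:M.
Proof.
rewrite mulmx_diag; apply/matrixP => i j; rewrite !mxE.
by have := sqrt_lam_neq0 i; rewrite mxE => /mulVf ->.
Qed.

Lemma form_of_row_C i : form_of (row i C) = q i.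
Proof. by rewrite row_coefs_family form_ofK. Qed.

Lemma f2_gram : f2 = gram_form (S^T *m S).
Proof.
rewrite gram_form_sos; apply: eq_bigr => i _.
have -> : row i S = (Num.sqrt (lam i) *: delta_mx 0 i) *m C.
  by rewrite -scalemxAl -rowE row_mul row_diag_mx mxE -scalemxAl -rowE.
rewrite -scalemxAl -rowE.
have -> : form_of (Num.sqrt (lam i) *: row i C) = Num.sqrt (lam i) *: q i.
  rewrite -form_of_row_C /form_of scaler_sumr; apply: eq_bigr => j _.
  by rewrite mxE scalerA.
by rewrite exprZn sqr_sqrtr // ltW.
Qed.

Lemma S_row_free : row_free S.
Proof.
have /row_freeP[T CT] := cubic_mx_row_free_forms C_free.
apply/row_freeP; exists (T *m diag_mx (map_mx GRing.inv sl)).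
by rewrite /S mulmxA -(mulmxA _ C) CT mulmx1 (mulmx1C sqrt_lam_inv).
Qed.

Lemma m_le_N : (m <= N)%N.
Proof. by rewrite -(eqP S_row_free) rank_leq_col. Qed.

Lemma eval_gram_prog : ev (gram_prog n k) = S^T *m S.
Proof.
set X := ev _.
have [[psdX AX] _] : sdp_optimal 0 (bmx R (gram_constraints n k)) (coefs (2 * k) f2) X.
  have -> : X = sdp 0 (bmx R (gram_constraints n k)) (coefs (2 * k) f2).
    rewrite /X /= conform_mx_id; congr (sdp _ _ _).
    by apply/matrixP => i j; rewrite !mxE.
  apply: sdpP; exists (S^T *m S); split.
    by split; [apply: psd_mulmx_tr | rewrite gram_constraintsE -f2_gram].
  by move=> Y _; rewrite trmx0 !mul0mx.
have {AX} f2X : f2 = gram_form X.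
  apply/eqP; rewrite -subr_eq0; apply/eqP/(@coefs_inj _ _ (2 * k)).
    by rewrite rpredB ?gram_form_homog ?weighted_powers_homog.
  move: AX; rewrite gram_constraintsE => /trmx_inj e.
  by apply/rowP => j; have /rowP/(_ j) := e; rewrite !mxE mcoeffB => ->; rewrite subrr.
(* Uniqueness concerns representations rather than Gram matrices, so [X] is turned into one by its
   spectral square root. *)
have := eigP psdX.1; case: (eig X) => P d [PP PdP _].
have d0 : forall i, 0 <= d 0 i by apply: (psd_eig_ge0 PP); rewrite PdP.
have e := diag_sqrt_sq P d0.
(* [S] is padded with zero rows, since the square root of [X] has [N] rows and only representations
   of equal length are compared. *)
pose W : 'M[R]_N := pid_mx m *m S.
have WS : W^T *m W = S^T *m S.
  rewrite trmx_mul mulmxA -(mulmxA S^T) tr_pid_mx pid_mx_id ?m_le_N //.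
  by rewrite pid_mx_1 mulmx1.
rewrite -WS -PdP -e; apply: (uniquely_sos_gram f2_unique).
  by rewrite e PdP.
by rewrite WS f2_gram.
Qed.

Lemma eval_basis_prog :
  exists2 O : 'M[R]_m, O *m O^T = 1%:M & ev (basis_prog n m k) = O *m S.
Proof.
apply: (orthogonal_factor S_row_free).
rewrite /basis_prog !eval_MulE eval_diag_prog.
rewrite -[ev (Sqrt _)]/(map_mx Num.sqrt (eig (ev (gram_prog n k))).2).
rewrite -[ev (EigVec _)]/((eig (ev (gram_prog n k))).1) eval_gram_prog.
have := eigP (psd_mulmx_tr S).1; case: (eig (S^T *m S)) => P d [PP PdP dS] /=.
have -> : map_mx (fun b : bool => b%:R) (\matrix_(i < m, j < N) (i == j :> nat))
    = pid_mx m :> 'M[R]_(m, N).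
  by apply/matrixP => i j; rewrite !mxE ltn_ord andbT.
exact: (sqrt_eig_top m_le_N PP PdP dS).
Qed.

(** The permutation [s] is the order in which the second eigendecomposition lists the forms. *)
Lemma eval_recovery_prog :
  exists2 s : 'I_m -> 'I_m, bijective s &
    forall i, row i (lsubmx (ev (recovery_prog n m k))) = row (s i) C /\
              rsubmx (ev (recovery_prog n m k)) i 0 = lam (s i).
Proof.
have [O OO VOS] := eval_basis_prog; set V := ev (basis_prog n m k) in VOS.
(* [B] inverts [O *m diag_mx sl] and so expresses the unknown forms in the computed basis [V]. *)
pose B := diag_mx (map_mx GRing.inv sl) *m O^T.
have BV : B *m V = C.
  rewrite VOS /B mulmxA -(mulmxA _ O^T) (mulmx1C OO) mulmx1 /S mulmxA.
  by rewrite sqrt_lam_inv mul1mx.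
have V_free : row_free (cubic_mx V).
  rewrite VOS /S mulmxA; apply: (@cubic_mx_row_free _ _ _ _ _ _ B) => //.
  by rewrite /B mulmxA -(mulmxA O) (mulmx1C sqrt_lam_inv) mulmx1.
have tE : ev (tensor_prog n m k) = weighted_tensor lam B.
  rewrite /tensor_prog eval_MulE.
  have -> : ev (Solve (cubic_prog n m k) (Var 1 (nmon n (3 * k)) 1)) =
      coefs (3 * k) f3 *m pinvmx (cubic_mx V).
    by rewrite -eval_cubic_prog /= conform_mx_id.
  have -> : f3 = \sum_i lam i *: form_of (row i (B *m V)) ^+ 3.
    by rewrite BV; apply: eq_bigr => i _; rewrite form_of_row_C.
  rewrite coefs_weighted_cubes; apply: solve_cubic V_free _.
  exact: weighted_tensor_symmetric.
pose D : 'rV[R]_m := \row_i lead_coefs C i 0.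
(* The weights cancel here: [B] contributes the inverse of [sl] on both sides of [lam i], which is
   the square of [sl 0 i]. *)
have KE : ev (contraction_prog n m k) = O *m diag_mx D *m O^T.
  rewrite -[LHS]/(vec_mx (map2_mx *%R (ev (tensor_prog n m k))
     ((V *m bmx R (lead_mon n k))^T *m bmx R (select_fst m)) *m bmx R (select_rest m))).
  rewrite tE contract_weighted_tensor (mulmxA B V) BV -/(lead_coefs C).
  rewrite /B trmx_mul trmxK tr_diag_mx -!mulmxA; congr (_ *m _); rewrite !mulmxA.
  congr (_ *m _); rewrite !mulmx_diag; congr diag_mx; apply/rowP => i.
  rewrite !mxE; set l := Num.sqrt _.
  have l0 : l != 0 by rewrite gt_eqF // sqrtr_gt0.
  by rewrite -[lam i]sqr_sqrtr ?ltW // -/l expr2 mulrC -mulrA !mulKf.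
have : (ev (contraction_prog n m k))^T = ev (contraction_prog n m k).
  by rewrite KE !trmx_mul trmxK tr_diag_mx mulmxA.
move/eigP.
have rE : ev (powers_prog n m k) = (eig (ev (contraction_prog n m k))).1 *m V by [].
have dE : ev (EigVal (contraction_prog n m k)) = (eig (ev (contraction_prog n m k))).2 by [].
move: rE dE; rewrite KE.
case: (eig _) => Q d rE dE [QQ QdQ _].
(* [W] compares two orthogonal diagonalizations of the same matrix; the distinct leading
   coefficients make it a signed permutation. *)
pose W := Q *m O.
have WW : W *m W^T = 1%:M by rewrite /W trmx_mul mulmxA -(mulmxA Q) OO mulmx1.
have WD : W *m diag_mx D *m W^T = diag_mx d.
  rewrite /W trmx_mul !mulmxA -(mulmxA Q O) -(mulmxA Q) -QdQ !mulmxA QQ mul1mx.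
  by rewrite -mulmxA QQ mulmx1.
have [|s [bij_s W1 W0 ds]] := orthogonal_diag _ WW WD.
  by move=> i j; rewrite [D 0 i]mxE [D 0 j]mxE => /lead_inj.
exists s => // i.
have rS : ev (powers_prog n m k) = W *m S by rewrite rE VOS; apply: mulmxA.
(* This is [sqrt (lam (s i))] up to sign; the sign disappears in [w^-1 * w] and in [w ^+ 2]. *)
pose w := W i (s i) * sl 0 (s i).
have w0 : w != 0.
  by rewrite mulf_neq0 ?sqrt_lam_neq0 // -sqrf_eq0 W1 oner_eq0.
have rij j : ev (powers_prog n m k) i j = w * C (s i) j.
  rewrite rS mxE (bigD1 (s i)) //= big1 ?addr0 => [|l /W0 ->]; last by rewrite mul0r.
  by rewrite /S mul_diag_mx [X in _ * X]mxE mulrA.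
have ratioE : ev (ratio_prog n m k) i 0 = w^-1.
  rewrite /ratio_prog eval_HadE.
  have -> : ev (Tr (EigVal (contraction_prog n m k))) i 0 = d 0 i.
    by rewrite -[LHS]/((ev (EigVal (contraction_prog n m k)))^T i 0) mxE dE.
  have -> : ev (Inv (Mul (powers_prog n m k) (Const (lead_mon n k)))) i 0 =
      (w * lead_coefs C (s i) 0)^-1.
    rewrite -[LHS]/(map_mx GRing.inv (ev (powers_prog n m k) *m bmx R (lead_mon n k)) i 0).
    rewrite mxE; congr (_^-1); rewrite !mxE mulr_sumr.
    by apply: eq_bigr => j _; rewrite rij !mxE mulrA.
  by rewrite ds mxE invfM mulrCA divff // mulr1.
have out j : ev (recovery_prog n m k) i j =
   \sum_l ev (powers_prog n m k) i l * ev (ratio_prog n m k) i 0 * (l == j :> nat)%:R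
   + (ev (ratio_prog n m k) i 0)^-1 ^+ 2 * (j == N :> nat)%:R.
  have -> : ev (recovery_prog n m k) i j =
    (map2_mx *%R (ev (powers_prog n m k)) (ev (ratio_prog n m k) *m bmx R (const_mx true))
       *m bmx R (\matrix_(l, j) (l == j :> nat))) i j +
    (map2_mx *%R (map_mx GRing.inv (ev (ratio_prog n m k)))
       (map_mx GRing.inv (ev (ratio_prog n m k)))
       *m bmx R (\matrix_(l, j) (j == N :> nat))) i j by rewrite [LHS]mxE.
  congr (_ + _); last by rewrite mxE big_ord1 !mxE expr2.
  rewrite mxE; apply: eq_bigr => l _.
  rewrite [X in X * _]mxE [X in _ * X * _]mxE big_ord1 /bmx.
  by rewrite [X in _ * X]mxE [X in _ * (_ * X) * _]mxE !mxE mulr1.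
split.
  apply/rowP => j; rewrite 2![LHS]mxE out ratioE [RHS]mxE (bigD1 j) //= big1.
    by rewrite eqxx (ltn_eqF (ltn_ord j)) mulr0 !addr0 mulr1 rij mulrC mulrA mulVf ?mul1r.
  by move=> l lj; rewrite -val_eqE /= in lj; rewrite (negPf lj) mulr0.
rewrite mxE out ratioE invrK /= addn0 eqxx mulr1 big1 ?add0r.
  by rewrite /w exprMn W1 mul1r mxE sqr_sqrtr // ltW.
by move=> l _; rewrite (ltn_eqF (ltn_ord l)) mulr0.
Qed.

Lemma decode_recovery_prog :
  decode (ev (recovery_prog n m k)) = range (fun i => (q i, lam i)).
Proof.
have [s [t sK tK] sP] := eval_recovery_prog.
have e i : (form_of (row i (lsubmx (ev (recovery_prog n m k)))),
            rsubmx (ev (recovery_prog n m k)) i 0) = (q (s i), lam (s i)).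
  by have [-> ->] := sP i; rewrite form_of_row_C.
apply/seteqP; split => [_ [i _ <-]|_ [i _ <-]] /=; first by exists (s i).
by exists (t i) => //; rewrite e tK.
Qed.

End Correctness.

(** * Genericity and cost *)

Section Genericity.

(** Any commutative ring is allowed, so that the same expression can be taken at a real matrix,
    along a line over [{poly R}], and at a matrix of variables. *)
Definition genericity (A : comPzRingType) m n k (V : 'M[A]_(m, nmon n k))
    (B : 'M[A]_(nmon n (3 * k), nmon m 3)) : A :=
  \det (cubic_mx V *m B) * \prod_i lead_coefs V i 0 *
  \prod_i \prod_(j | j != i) (lead_coefs V i 0 - lead_coefs V j 0).

Lemma map_lead_coefs (A A' : pzRingType) (f : {rmorphism A -> A'}) m n k
    (V : 'M[A]_(m, nmon n k)) i :
  f (lead_coefs V i 0) = lead_coefs (map_mx f V) i 0.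
Proof.
by rewrite /lead_coefs -(map_bmx f) -map_mxM [RHS]mxE.
Qed.

Lemma rmorph_genericity (A A' : comPzRingType) (f : {rmorphism A -> A'}) m n k
    (V : 'M[A]_(m, nmon n k)) B :
  f (genericity V B) = genericity (map_mx f V) (map_mx f B).
Proof.
rewrite /genericity !rmorphM /= -det_map_mx map_mxM map_cubic_mx !rmorph_prod.
congr (_ * _ * _); first by apply: eq_bigr => i _; apply: map_lead_coefs.
apply: eq_bigr => i _; rewrite rmorph_prod; apply: eq_bigr => j _.
by rewrite rmorphB /= !map_lead_coefs.
Qed.

Lemma genericity_neq0 (F : fieldType) m n k (V : 'M[F]_(m, nmon n k)) B :
  genericity V B != 0 ->
  [/\ row_free (cubic_mx V), forall i, lead_coefs V i 0 != 0
    & injective (fun i => lead_coefs V i 0)].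
Proof.
rewrite !mulf_eq0 !negb_or => /andP[/andP[det0 /prodf_neq0 l0] /prodf_neq0 d0].
split=> [|i|i j e]; last 1 first.
- apply/eqP; apply: contraT => ij; have /prodf_neq0 := d0 j isT.
  by move=> /(_ i ij); rewrite e subrr eqxx.
- apply/row_freeP; exists (B *m invmx (cubic_mx V *m B)).
  by rewrite mulmxA mulmxV // unitmxE unitfE.
- exact: l0.
Qed.

Variable R : realType.

Lemma poly_eq0_eval (p : {poly R}) : (forall s, p.[s] = 0) -> p = 0.
Proof.
move=> p0; apply/eqP; apply: contraT => nz.
have := max_poly_roots nz (rs := [seq i%:R | i <- iota 0 (size p)]).
rewrite size_map size_iota ltnn => -> //.
  by apply/allP => x _; apply/rootP.
by rewrite map_inj_uniq ?iota_uniq // => i j /eqP; rewrite eqr_nat => /eqP.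
Qed.

(* Moving a cubically independent tuple along a line whose leading coefficients move at the
   speeds 1, ..., m avoids all the hypersurfaces at once. *)
Lemma exists_generic m n k (C : 'M[R]_(m, nmon n k)) B :
  (m <= nmon n k)%N -> cubic_mx C *m B = 1%:M ->
  exists V : 'M[R]_(m, nmon n k), genericity V B != 0.
Proof.
move=> mN CB; apply: contrapT => none.
have all0 V : genericity V B = 0.
  by apply/eqP; apply: contrapT => /negP nz; apply: none; exists V.
pose W : 'M[R]_(m, nmon n k) := \matrix_(i, j) (i.+1)%:R.
pose L : 'M[{poly R}]_(m, nmon n k) := map_mx polyC C + 'X *: map_mx polyC W.
pose g := genericity L (map_mx polyC B).
have mapL s : map_mx (horner_eval s) L = C + s *: W.
  apply/matrixP => i j; rewrite !mxE /horner_eval.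
  by rewrite hornerD hornerM hornerX !hornerC.
have mapB s : map_mx (horner_eval s) (map_mx polyC B) = B.
  by apply/matrixP => i j; rewrite !mxE /horner_eval hornerC.
have g0 : g = 0.
  apply: poly_eq0_eval => s.
  by rewrite -[LHS]/(horner_eval s g) rmorph_genericity mapL mapB.
have leadW i : lead_coefs W i 0 = (i.+1)%:R.
  have N0 : (0 < nmon n k)%N by apply: leq_ltn_trans (leq0n i) (leq_trans (ltn_ord i) mN).
  rewrite mxE (bigD1 (Ordinal N0)) //= !mxE eqxx mulr1 big1 ?addr0 // => j j0.
  by rewrite -val_eqE /= in j0; rewrite !mxE (negPf j0) mulr0.
have leadL i : lead_coefs L i 0 = (lead_coefs C i 0)%:P + 'X * (i.+1)%:R%:P.
  rewrite /lead_coefs mulmxDl -scalemxAl -!(map_bmx polyC) -!map_mxM.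
  by rewrite !mxE -/(lead_coefs W) -leadW !mxE.
suff : g != 0 by rewrite g0 eqxx.
(* Over the integral domain [{poly R}] the factors are treated separately: the determinant is 1 at
   the parameter 0, and the linear factors have nonzero coefficient at ['X]. *)
rewrite /g /genericity !mulf_neq0 //.
- apply/eqP => /(congr1 (horner_eval 0)); rewrite -det_map_mx map_mxM map_cubic_mx.
  rewrite mapL mapB scale0r addr0 CB det1 /horner_eval horner0 => /eqP.
  by rewrite oner_eq0.
- apply/prodf_neq0 => i _; rewrite leadL; apply/eqP => /polyP/(_ 1%N).
  rewrite coefD coefXM !coefC /= add0r => /eqP.
  by rewrite pnatr_eq0.
- apply/prodf_neq0 => i _; apply/prodf_neq0 => j ji; rewrite !leadL.
  apply/eqP => /polyP/(_ 1%N).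
  rewrite coefB !coefD !coefXM !coefC /= !add0r => /eqP.
  by rewrite subr_eq0 eqr_nat eqSS => /eqP/val_inj e; rewrite e eqxx in ji.
Qed.

Lemma genericity_zariski_closed m n k B :
  zariski_closed [set V : 'M[R]_(m, nmon n k) | genericity V B = 0]%classic.
Proof.
pose X : 'M[{mpoly R[m * nmon n k]}]_(m, nmon n k) :=
  \matrix_(i, j) 'X_(mxvec_index i j).
exists [set genericity X (map_mx (@mpolyC _ _) B)]%classic.
have e V : (genericity X (map_mx (@mpolyC _ _) B)).@[fun j => mxvec V 0 j]
    = genericity V B.
  rewrite (rmorph_genericity (meval _)).
  have -> : map_mx (meval (fun j => mxvec V 0 j)) X = V.
    by apply/matrixP => i j; rewrite !mxE mevalXU mxvecE.
  congr genericity.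
  by apply/matrixP => i j; rewrite !mxE; apply: mevalC.
apply/seteqP; split=> V /=; first by move=> V0 _ ->; rewrite e.
by move=> /(_ _ erefl); rewrite e.
Qed.

(** The first [m] forms of an independent tuple of maximal length remain independent. *)
Lemma beta_row_free n k m : (m <= beta R n k)%N ->
  exists C : 'M[R]_(m, nmon n k), row_free (cubic_mx C).
Proof.
rewrite /beta; case: ex_maxnP => b /asboolP[q [hq free_q]] _ mb.
exists (pid_mx m *m coefs_family k q).
apply: (@cubic_mx_row_free _ _ _ _ _ _ (pid_mx m)).
  by rewrite pid_mx_id // pid_mx_1.
exact: no_cubic_relation_row_free.
Qed.

End Genericity.

(** * Polynomial bound on the cost *)

Fixpoint ops p q (e : prog p q) : nat :=
  match e with
  | Var _ _ _ | Const _ _ _ => 1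
  | Let _ _ _ _ a b | Add _ _ a b | Mul _ _ _ a b | Had _ _ a b
  | Solve _ _ _ a b => 1 + ops a + ops b
  | Opp _ _ a | Tr _ _ a | Vec _ _ a | Unvec _ _ a | Inv _ _ a | Sqrt _ _ a
  | Ker _ _ a | EigVec _ a | EigVal _ a => 1 + ops a
  | Sdp _ _ a b c => 1 + ops a + ops b + ops c
  | If _ _ a b c => 1 + ops a + ops b + ops c
  end%N.

Fixpoint dims_le (D : nat) p q (e : prog p q) : bool :=
  (p <= D)%N && (q <= D)%N &&
  match e with
  | Var _ _ _ | Const _ _ _ => true
  | Let _ _ _ _ a b => dims_le D a && dims_le D b
  | Add _ _ a b => dims_le D a && dims_le D b
  | Mul _ _ _ a b => dims_le D a && dims_le D b
  | Had _ _ a b => dims_le D a && dims_le D b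
  | Solve _ _ _ a b => dims_le D a && dims_le D b
  | Opp _ _ a => dims_le D a
  | Tr _ _ a => dims_le D a
  | Vec _ _ a => dims_le D a
  | Unvec _ _ a => dims_le D a
  | Inv _ _ a => dims_le D a
  | Sqrt _ _ a => dims_le D a
  | Ker _ _ a => dims_le D a
  | EigVec _ a => dims_le D a
  | EigVal _ a => dims_le D a
  | Sdp _ _ a b c => [&& dims_le D a, dims_le D b & dims_le D c]
  | If _ _ a b c => [&& dims_le D a, dims_le D b & dims_le D c]
  end.

Lemma cost_le_ops D p q (e : prog p q) :
  dims_le D e -> (cost e <= ops e * (1 + D * D))%N.
Proof.
elim: e => /= *;
  repeat match goal with H : is_true (_ && _) |- _ => case/andP: H => ? ? end;
  repeat match goal with H : is_true ?a -> _, H' : is_true ?a |- _ =>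
    specialize (H H') end;
  rewrite ?[leqRHS]mulnDl ?mulnDl ?mul1n ?leq_add //;
  (* The second alternative serves operations that produce a row vector: its length is at most [D],
     and [1 <= D] bounds the number of rows. *)
  solve [exact: leq_mul | by rewrite (leq_trans (n := D)) // leq_pmulr].
Qed.

(** Doubling exponents is injective. The bound is needed because the input size only counts
    coefficients in degrees [2 * k] and [3 * k]. *)
Lemma nmon_le_double n k : (nmon n k <= nmon n (2 * k))%N.
Proof.
rewrite /nmon -(size_map (fun u => u + u)%MM); apply: uniq_leq_size.
  rewrite map_inj_uniq ?monomials_uniq // => u v /mnmP e; apply/mnmP => i.
  by have := e i; rewrite !mnmDE !addnn => /double_inj.
move=> _ /mapP[u + ->]; rewrite !mem_monomials => /eqP du.
by rewrite mdegD du addnn mul2n.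
Qed.

(** The cube accounts for the tensor indices; the strict bound on [nmon n k] leaves room for the
    column of weights. *)
Lemma dims_le_recovery_prog D n m k :
  (0 < D)%N -> (m <= nmon n k)%N -> (nmon n k < D)%N -> (nmon n (2 * k) <= D)%N ->
  (nmon n (3 * k) <= D)%N -> (nmon m 3 <= D)%N ->
  dims_le (D ^ 3) (recovery_prog n m k).
Proof.
move=> D0 mN ND h2 h3 hm; set N := nmon n k in mN ND *.
have D1 : (D <= D ^ 3)%N by rewrite -{1}(expn1 D) leq_pexp2l.
have D2 : (D ^ 2 <= D ^ 3)%N by rewrite leq_pexp2l.
have mD : (m <= D)%N by apply: leq_trans mN (ltnW ND).
have sq a : (a <= D)%N -> (a * a <= D ^ 3)%N.
  by move=> h; apply: leq_trans D2; rewrite expnS expn1 leq_mul.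
have cu a : (a <= D)%N -> (a * a * a <= D ^ 3)%N.
  by move=> h; rewrite expnSr expnS expn1 !leq_mul.
have e1 : (1 <= D ^ 3)%N by rewrite expn_gt0 D0.
have e2 := leq_trans mD D1.
have e3 := leq_trans (ltnW ND) D1.
have e4 : (N + 1 <= D ^ 3)%N by rewrite addn1 (leq_trans ND).
have [e5 e6] := (leq_trans h2 D1, leq_trans h3 D1).
have e7 := leq_trans hm D1.
have [e8 e9] := (sq m mD, sq N (ltnW ND)).
have [e10 e11] := (cu m mD, cu N (ltnW ND)).
have E := (e1, e2, e3, e4, e5, e6, e7, e8, e9, e10, e11).
have hb : dims_le (D ^ 3) (basis_prog n m k) by rewrite /= -/N !E.
have ht : dims_le (D ^ 3) (tensor_prog n m k).
  by rewrite /tensor_prog /cubic_prog /tens3_prog /select_prog; move: hb => /=; rewrite -/N !E.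
have hc : dims_le (D ^ 3) (contraction_prog n m k).
  by rewrite /contraction_prog; move: hb ht => /=; rewrite -/N !E.
by rewrite /= -/N !E.
Qed.

Theorem corollary1p3 (R : realType) :
  exists c d : nat, forall n m k : nat, (m <= beta R n k)%N ->
    exists alg : prog m (nmon n k + 1),
      (cost alg <= c * (input_size n k + 1) ^ d)%N /\
      solves_generically R alg.
Proof.
(* The operation count is the same for all dimensions, so it is read off at 0. With all dimensions
   at most [D ^ 3], each operation costs at most [1 + D ^ 6 <= 2 * D ^ 6]. *)
exists (2 * ops (recovery_prog 0 0 0))%N, 6 => n m k m_le.
have [C C_free] := beta_row_free m_le.
have mN : (m <= nmon n k)%N.
  by rewrite -(eqP (cubic_mx_row_free_forms C_free)) rank_leq_col.
exists (recovery_prog n m k); split.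
  set D := (input_size n k + 1)%N.
  have D0 : (0 < D)%N by rewrite /D addn1.
  have h2 : (nmon n (2 * k) < D)%N by rewrite /D addn1 ltnS leq_addr.
  have h3 : (nmon n (3 * k) <= D)%N by rewrite /D addn1 leqW // leq_addl.
  (* A row free [cubic_mx C] has at most as many rows as columns. *)
  have hm : (nmon m 3 <= D)%N.
    by apply: leq_trans h3; rewrite -(eqP C_free) rank_leq_col.
  have := dims_le_recovery_prog D0 mN (leq_ltn_trans (nmon_le_double n k) h2) (ltnW h2) h3 hm.
  move=> /cost_le_ops/leq_trans; apply.
  rewrite (_ : ops (recovery_prog n m k) = ops (recovery_prog 0 0 0)) //.
  rewrite -expnD -mulnA mulnCA leq_mul2l mul2n -addnn leq_add2r expn_gt0 D0.
  by rewrite orbT.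
(* The exceptional set is cut out with this one [B], attached to a single independent tuple; it does
   not depend on the weights. *)
have [B CB] := row_freeP C_free.
exists [set V | genericity V B = 0]%classic; split.
- exact: genericity_zariski_closed.
- have [V /eqP V0] := exists_generic mN CB.
  by move=> /seteqP[_ /(_ V I)].
move=> q lam hq lam0 /= /eqP/genericity_neq0[free_q lead0 lead_inj] uniq_f sdp eig sdpP eigP.
exact: (decode_recovery_prog sdpP eigP hq lam0 uniq_f free_q lead0 lead_inj).
Qed.
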